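(* Let $p$ be a prime and let $G$ be a transitive group of degree $p^2$ (a transitive subgroup of $S_{p^2}$) with Sylow $p$-subgroup $P$. Let $|P|=p^{i+1}$, $i\ge 1$. (1) If $\tau\in P$, then $P=P_i$. (2) If $\langle\rho_1,\rho_2\rangle\le P$, then $P=\alpha^{-1}P_i'\alpha$ for some $\alpha\in\mathrm{Aut}(\mathbb{Z}_p^2)$.
   Context: $S_{p^2}$ acts on $\mathbb{Z}_p\times\mathbb{Z}_p$, identified with $\mathbb{Z}_{p^2}$ via $(a,b)\mapsto a+bp$ ($0\le a,b\le p-1$). Define permutations: $\tau(x)=x+1 \pmod{p^2}$ on $\mathbb{Z}_{p^2}$; $\rho_1(i,j)=(i,j+1)$ and $\rho_2(i,j)=(i+1,j)$ on $\mathbb{Z}_p^2$; and, for $0\le k\le p-1$, $z_k$ maps $(k,b)$ to $(k,b+1)$ and fixes all $(a,b)$ with $a\ne k$. Put $a_{m,k}=\binom{m}{k}(-1)^{m-k}$ and, for $1\le i\le p$, $\gamma_i=z_0^{a_{p-i,0}}z_1^{a_{p-i,1}}\cdots z_{p-1}^{a_{p-i,p-1}}$. For $1\le i\le p$ let $P_i=\langle\tau,\gamma_i\rangle$ and $P_i'=\langle\rho_1,\rho_2,\gamma_i\rangle$. $\mathrm{Aut}(\mathbb{Z}_p^2)$ is the group of group automorphisms of $\mathbb{Z}_p^2$, viewed as permutations of $\mathbb{Z}_p^2$. *)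

(* Defs.v *)
From HB Require Import structures.
From mathcomp Require Import all_boot all_order all_algebra all_fingroup.
From mathcomp Require Import all_solvable.

Set Implicit Arguments.
Unset Strict Implicit.
Unset Printing Implicit Defensive.

Import GRing.Theory.

Definition pt (p : nat) : finGroupType := ('Z_p * 'Z_p)%type.

(* The identification (a, b) |-> a + b p of Z_p x Z_p with Z_(p^2), where a and
   b are the representatives in [0, p - 1]; it is a bijection when 1 < p, see
   [toZp2K] and [ofZp2K]. *)
Definition toZp2 (p : nat) (x : pt p) : 'Z_(p ^ 2) := inZp (x.1 + x.2 * p).
Definition ofZp2 (p : nat) (y : 'Z_(p ^ 2)) : pt p := (inZp y, inZp (y %/ p)).

Lemma toZp2K (p : nat) : prime p -> cancel (@toZp2 p) (@ofZp2 p).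
Proof.
move=> /prime_gt1 p1 [a b].
have p0 := ltnW p1.
have p21 : 1 < p ^ 2 by rewrite (ltn_trans p1) // -{1}(expn1 p) ltn_exp2l.
have la : a < p by have := ltn_ord a; rewrite {2}Zp_cast.
have lb : b < p by have := ltn_ord b; rewrite {2}Zp_cast.
have lt : a + b * p < p ^ 2.
  apply: (@leq_trans (b.+1 * p)); first by rewrite mulSn ltn_add2r.
  by rewrite -mulnn leq_mul2r lb orbT.
have e : toZp2 ((a, b) : pt p) = a + b * p :> nat.
  by rewrite /= (Zp_cast p21) modn_small.
rewrite /ofZp2 e; congr pair; apply: val_inj; rewrite [LHS]/= [X in _ %% X]Zp_cast //.
  by rewrite addnC modnMDl modn_small.
by rewrite addnC divnMDl // divn_small // addn0 modn_small.
Qed.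

Lemma ofZp2K (p : nat) : prime p -> cancel (@ofZp2 p) (@toZp2 p).
Proof.
move=> /prime_gt1 p1 y.
have p21 : 1 < p ^ 2 by rewrite (ltn_trans p1) // -{1}(expn1 p) ltn_exp2l.
have ly : y < p ^ 2 by have := ltn_ord y; rewrite {2}Zp_cast.
have e1 : (ofZp2 y).1 = y %% p :> nat by rewrite /= [X in _ %% X]Zp_cast.
have e2 : (ofZp2 y).2 = y %/ p :> nat.
  by rewrite /= [X in _ %% X]Zp_cast // modn_small // ltn_divLR ?(ltnW p1) // mulnn.
apply: val_inj; rewrite /toZp2 e1 e2 [LHS]/= [X in _ %% X]Zp_cast //.
by rewrite addnC -divn_eq modn_small.
Qed.

(* tau is x |-> x + 1 on Z_(p^2), carried over to Z_p x Z_p. *)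
Definition tau_fun (p : nat) (x : pt p) : pt p := ofZp2 (toZp2 x + 1)%R.

Lemma tau_inj (p : nat) : prime p -> injective (@tau_fun p).
Proof.
move=> p_pr x y /(can_inj (ofZp2K p_pr)) /addIr.
exact: (can_inj (toZp2K p_pr)).
Qed.

Definition tau (p : nat) (p_pr : prime p) : {perm pt p} := perm (tau_inj p_pr).

Definition rho1_fun (p : nat) (x : pt p) : pt p := (x.1, (x.2 + 1)%R).

Lemma rho1_inj (p : nat) : injective (@rho1_fun p).
Proof.
move=> [a b] [c d] e; have /= -> := congr1 fst e.
by have /= /addIr -> := congr1 snd e.
Qed.

Definition rho1 (p : nat) : {perm pt p} := perm (@rho1_inj p).

Definition rho2_fun (p : nat) (x : pt p) : pt p := ((x.1 + 1)%R, x.2).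

Lemma rho2_inj (p : nat) : injective (@rho2_fun p).
Proof.
move=> [a b] [c d] e; have /= -> := congr1 snd e.
by have /= /addIr -> := congr1 fst e.
Qed.

Definition rho2 (p : nat) : {perm pt p} := perm (@rho2_inj p).

Definition z_fun (p k : nat) (x : pt p) : pt p :=
  if x.1 == k :> nat then (x.1, (x.2 + 1)%R) else x.

Lemma z_inj (p k : nat) : injective (@z_fun p k).
Proof.
move=> [a b] [c d] e.
have ac : a = c.
  by move: (congr1 fst e); rewrite /z_fun /=; case: ifP; case: ifP.
move: (congr1 snd e); rewrite /z_fun /= ac.
by case: ifP => _ /= => [/addIr|] ->.
Qed.

Definition z (p k : nat) : {perm pt p} := perm (@z_inj p k).

Definition expgz (gT : finGroupType) (x : gT) (m : int) : gT :=
  match m with Posz n => (x ^+ n)%g | Negz n => (x ^- n.+1)%g end.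

(* For k > m the truncated exponent m - k is harmless since 'C(m, k) = 0. *)
Definition acoef (m k : nat) : int := ('C(m, k)%:Z * (-1) ^+ (m - k))%R.

(* Meant for 1 <= i <= p, where p - i is the true difference; a p-subgroup of
   {perm pt p} of order p ^ i.+1 has i <= p, as p ^ p.+2 does not divide
   (p ^ 2)`!. *)
Definition gamma (p i : nat) : {perm pt p} :=
  (\prod_(k < p) expgz (z p k) (acoef (p - i) k))%g.

Definition Pgrp (p : nat) (p_pr : prime p) (i : nat) : {group {perm pt p}} :=
  <<[set tau p_pr; gamma p i]>>%G.

Definition Pgrp' (p i : nat) : {group {perm pt p}} :=
  <<[set rho1 p; rho2 p; gamma p i]>>%G.

(* Main.v *)
(* Since P is a p-group, its centre has a nontrivial element c.  It commutes
   with tau, resp. with all translations; each of these groups is regular and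
   abelian, hence self-centralizing.  So rho1 is central in P when tau is in P
   (rho1 = tau ^+ p generates the only subgroup of order p of <[tau]>), while in
   the other case c is a nonzero translation, which a linear map conjugates to
   rho1.  In both cases P may be assumed to centralize rho1 and to contain
   s = tau or s = rho2, which adds 1 to the first coordinate.  Then P permutes
   the p fibres of the first coordinate cyclically, and the kernel K of this
   action is an s-invariant group of order p ^ i of shears
   (a, b) |-> (a, b + f a).  The group A of all shears is uniserial under s:
   commutation with s is an endomorphism D of A whose kernel has order p, so the
   invariant subgroups are the kernels of the powers of D.  As gamma p i is
   D ^ (p - i) applied to z p 0, it lies in the kernel of D ^ i but not in that
   of D ^ (i - 1), so s and gamma p i generate P. *)

Require Import Defs.
From HB Require Import structures.
From mathcomp Require Import all_boot all_order all_algebra all_fingroup.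
From mathcomp Require Import all_solvable.

Set Implicit Arguments.
Unset Strict Implicit.
Unset Printing Implicit Defensive.
Import GRing.Theory.

Local Open Scope group_scope.

(** Induction on [m]. Commutation with [s] is an endomorphism of the abelian group [A] with kernel
    ['C_A[s]]. A nontrivial [K] contains this whole kernel, so it is the full preimage of its image,
    which has order smaller by a factor [p]. *)
Lemma uniserial_kerE (gT : finGroupType) (p : nat) (A : {group gT}) (s : gT) :
    prime p -> abelian A -> p.-group A -> s \in 'N(A) -> p.-elt s ->
    #|'C_A[s]| <= p ->
  forall (m : nat) (K : {group gT}), K \subset A -> s \in 'N(K) ->
    #|K| = (p ^ m)%N -> K :=: [set x in A | iter m (commg^~ s) x == 1].
Proof.
move=> p_pr abA pA nAs p_s leCp.
have phiM : {in A &, {morph commg^~ s : x y / x * y}}.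
  move=> x y Ax Ay; rewrite commMgJ conjgE [[~ x, s] * y](centsP abA) ?mulKg //.
  by rewrite groupM ?groupV ?memJ_norm.
pose phi := Morphism phiM.
elim=> [|m IHm] K sKA nKs cardK.
  rewrite (card1_trivg cardK); apply/setP=> x; rewrite !inE.
  by case: eqP => [->|]; rewrite ?group1 ?andbF.
have kerC : 'ker phi = 'C_A[s].
  apply/setP=> x; rewrite in_setI [RHS]in_setI cent1E; congr (_ && _); rewrite !inE /=.
  exact: (sameP commgP eqP).
(* [s] acts on the nontrivial [p]-group [K], so it has a nontrivial fixed point. *)
have geC : p <= #|'C_K[s]|.
  rewrite dvdn_leq ?cardG_gt0 //.
  have actK : [acts <[s]>, on K | 'J] by rewrite astabsJ cycle_subG.
  have := pgroup_fix_mod (p_s : p.-group <[s]>) actK.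
  rewrite afixJ cent_cycle => /eqP e; rewrite /dvdn -(eqP e) cardK.
  by rewrite -/(dvdn _ _) dvdn_exp.
(* [K] already has at least [p] fixed points, the bound for all of [A]. *)
have CK : 'C_K[s] = 'ker phi.
  by apply/eqP; rewrite kerC eqEcard setSI //= (leq_trans leCp).
have kerK : 'ker phi \subset K by rewrite -CK subsetIl.
have imA : phi @* K \subset A.
  apply/subsetP=> _ /morphimP[x Ax Kx ->] /=.
  by rewrite groupM ?groupV ?memJ_norm.
have imN : s \in 'N(phi @* K).
  rewrite inE; apply/subsetP=> _ /imsetP[_ /morphimP[x Ax Kx ->] ->] /=.
  rewrite conjRg [s ^ s]conjgE mulKg; apply/morphimP; exists (x ^ s) => //.
    by rewrite memJ_norm.
  by rewrite memJ_norm.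
have cKer : #|'C_K[s]| = p.
  by apply/eqP; rewrite eqn_leq geC CK kerC leCp.
have imcard : #|phi @* K| = (p ^ m)%N.
  rewrite card_morphim (setIidPr sKA) -CK -divgS ?subsetIl // cardK cKer.
  by rewrite expnS mulKn ?prime_gt0.
have imE := IHm _ imA imN imcard.
apply/setP=> x; rewrite inE iterSr; apply/idP/andP=> [Kx|[Ax /eqP e]].
  have Ax := subsetP sKA _ Kx; split=> //.
  have : phi x \in phi @* K by apply: mem_morphim.
  by rewrite imE inE => /andP[].
have : x \in phi @*^-1 (phi @* K).
  rewrite inE Ax /= inE imE inE /= e eqxx andbT.
  by rewrite groupM ?groupV ?memJ_norm.
by rewrite morphimK // mulSGid.
Qed.

(** * Shears and the centralizer of [rho1] *)

Section Shear.
Variable p : nat.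
Hypothesis p_pr : prime p.
Local Notation V := {ffun 'Z_p -> 'Z_p}.

Definition shear_fun (f : V) (x : pt p) : pt p := (x.1, (x.2 + f x.1)%R).

Lemma shear_inj (f : V) : injective (shear_fun f).
Proof.
by case=> [a b] [c d] e; move: (congr1 fst e) (congr1 snd e) => /= -> /addIr ->.
Qed.

Definition shear (f : V) : {perm pt p} := perm (@shear_inj f).

Lemma shearE f x : shear f x = (x.1, (x.2 + f x.1)%R).
Proof. by rewrite permE. Qed.

Lemma shearD f g : shear (f + g)%R = shear f * shear g.
Proof. by apply/permP=> x; rewrite permM !shearE /= ffunE addrA. Qed.

Lemma shear_injective : injective shear.
Proof.
move=> f g /permP e; apply/ffunP=> a.
by have := congr1 snd (e (a, 0%R)); rewrite !shearE /= !add0r.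
Qed.

Lemma shear0 : shear 0%R = 1.
Proof. by apply: (mulgI (shear 0%R)); rewrite -shearD addr0 mulg1. Qed.

Lemma shearN f : shear (- f)%R = (shear f)^-1.
Proof. by apply: (mulgI (shear f)); rewrite -shearD subrr shear0 mulgV. Qed.

Lemma shearMn f n : shear (f *+ n)%R = shear f ^+ n.
Proof.
elim: n => [|n IHn]; first by rewrite mulr0n shear0.
by rewrite mulrS shearD IHn expgS.
Qed.

Lemma shearMz f m : shear (f *~ m)%R = expgz (shear f) m.
Proof. by case: m => n /=; rewrite ?NegzE ?shearN shearMn. Qed.

Lemma shear_sum n (F : 'I_n -> V) :
  shear (\sum_(k < n) F k)%R = \prod_(k < n) shear (F k).
Proof. by apply: (big_morph shear shearD shear0). Qed.

(** This is the base group of the wreath product of Z_p by Z_p. *)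
Definition shears : {set {perm pt p}} := shear @: setT.

Lemma shears_group_set : group_set shears.
Proof.
apply/group_setP; split; first by rewrite -shear0 imset_f.
by move=> _ _ /imsetP[f _ ->] /imsetP[g _ ->]; rewrite -shearD imset_f.
Qed.
Canonical shears_group := Group shears_group_set.

Lemma shears_abelian : abelian shears.
Proof.
apply/centsP=> _ /imsetP[f _ ->] _ /imsetP[g _ ->].
by rewrite /commute -!shearD addrC.
Qed.

Let p_gt1 := prime_gt1 p_pr.

Lemma cardZp : #|'Z_p| = p.
Proof. by rewrite card_ord Zp_cast. Qed.

Lemma card_shears : #|shears| = (p ^ p)%N.
Proof.
by rewrite card_imset ?cardsT ?card_ffun ?cardZp //; apply: shear_injective.
Qed.

Lemma shears_pgroup : p.-group shears.
Proof. by rewrite /pgroup card_shears pnatX pnat_id. Qed.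

Lemma rho1E x : rho1 p x = (x.1, (x.2 + 1)%R).
Proof. by rewrite permE. Qed.

Lemma rho1_shear : rho1 p = shear [ffun=> 1%R].
Proof. by apply/permP=> x; rewrite rho1E shearE ffunE. Qed.

Lemma cent_rho1E (g : {perm pt p}) (x : pt p) (b : 'Z_p) :
  g \in 'C[rho1 p] -> g (x.1, (x.2 + b)%R) = ((g x).1, ((g x).2 + b)%R).
Proof.
move=> /cent1P cg; rewrite -(natr_Zp b); elim: (b : nat) => [|n IHn].
  by rewrite !addr0 -!surjective_pairing.
have /permP/(_ (x.1, (x.2 + n%:R)%R)) := cg.
by rewrite !permM !rho1E IHn /= -!addrA -mulrSr.
Qed.

(** The fibres of the first coordinate are the orbits of [rho1], so its centralizer permutes
    them. *)
Lemma cent_rho1_fst (g : {perm pt p}) (x y : pt p) :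
  g \in 'C[rho1 p] -> x.1 = y.1 -> (g x).1 = (g y).1.
Proof.
move=> cg e; have := cent_rho1E x (y.2 - x.2)%R cg.
by rewrite addrC subrK e -surjective_pairing => ->.
Qed.

(** On a fibre that it preserves, an element commuting with [rho1] is the translation determined by
    the image of the point with second coordinate 0. *)
Lemma mem_shears (g : {perm pt p}) :
  (g \in shears) = (g \in 'C[rho1 p]) && [forall x, (g x).1 == x.1].
Proof.
apply/imsetP/andP=> [[f _ ->]|[cg /forallP fg]].
  split; last by apply/forallP=> x; rewrite shearE.
  by apply/cent1P; rewrite /commute rho1_shear -!shearD addrC.
exists [ffun a => (g (a, 0%R)).2] => //; apply/permP=> x.
rewrite shearE ffunE; have := cent_rho1E (x.1, 0%R) x.2 cg.
by rewrite /= add0r -surjective_pairing => ->; rewrite (eqP (fg _)) addrC.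
Qed.

(** * An element [s] shifting the fibres, later [tau] or [rho2] *)

Section Sigma.
Variable s : {perm pt p}.
Hypothesis cs : s \in 'C[rho1 p].
Hypothesis s1 : forall x, (s x).1 = (x.1 + 1)%R.

Lemma shearJ f : shear f ^ s = shear [ffun a => f (a - 1)%R].
Proof.
apply/permP=> y; rewrite -[y](permKV s) permJ !shearE ffunE s1 addrK.
by rewrite cent_rho1E // s1.
Qed.

Lemma shears_norm : s \in 'N(shears).
Proof.
by rewrite inE; apply/subsetP=> _ /imsetP[_ /imsetP[f _ ->] ->]; rewrite shearJ imset_f.
Qed.

Lemma shear_comm f : [~ shear f, s] = shear [ffun a => f (a - 1) - f a]%R.
Proof.
rewrite commgEl shearJ -shearN -shearD; congr shear.
by apply/ffunP=> a; rewrite !ffunE addrC.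
Qed.

(** A shear commuting with [s] has f(a - 1) = f(a) for all a, so f is constant. *)
Lemma shears_cent : #|'C_shears[s]| <= p.
Proof.
rewrite -[leqRHS]cardZp.
apply: leq_trans (leq_imset_card (fun c => shear [ffun=> c]) 'Z_p).
apply: subset_leq_card; apply/subsetP=> _ /setIP[/imsetP[f _ ->]].
move=> /cent1P/commgP; rewrite shear_comm -shear0 => /eqP/shear_injective/ffunP e.
apply/imsetP; exists (f 0%R) => //; congr shear; apply/ffunP=> a.
rewrite ffunE -(natr_Zp a); elim: (a : nat) => // n IHn.
by have := e n.+1%:R%R; rewrite !ffunE mulrSr addrK IHn => /eqP; rewrite subr_eq0 => /eqP.
Qed.

Lemma s_expE n x : ((s ^+ n) x).1 = (x.1 + n%:R)%R.
Proof.
elim: n => [|n IHn]; first by rewrite perm1 addr0.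
by rewrite expgSr permM s1 IHn -addrA -mulrSr.
Qed.

Lemma fix_fibre_shears (g : {perm pt p}) :
  g \in 'C[rho1 p] -> p.-elt g -> (g (0%R, 0%R)).1 = 0%R -> g \in shears.
Proof.
move=> cg pg g0; rewrite mem_shears cg; apply/forallP=> x; apply/eqP.
pose h a := (g (a, 0%R)).1.
have hE y : (g y).1 = h y.1 by apply: cent_rho1_fst.
have h_inj : injective h.
  move=> a b e.
  (* Moving by [c - d] along the fibre over [b] compensates the difference of the two images within
     their common fibre. *)
  pose c := (g (a, 0) : pt p).2%R; pose d := (g (b, 0) : pt p).2%R.
  have : g (a, 0%R) = g (b, (c - d)%R).
    have /= := cent_rho1E (b, 0)%R (c - d)%R cg; rewrite add0r => ->.
    by rewrite -/d [(d + _)%R]addrC subrK -/(h b) -e -surjective_pairing.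
  by move/perm_inj=> [].
(* The permutation [hp] of the fibres has [p]-power order and fixes [0], so none
   of its orbits has size [p]: it is trivial. *)
pose hp := perm h_inj.
have hpX n y : (hp ^+ n) y.1 = ((g ^+ n) y).1.
  elim: n => [|n IHn]; first by rewrite !perm1.
  by rewrite !expgSr !permM IHn permE hE.
have php : p.-elt hp.
  have : #[hp] %| #[g].
    rewrite order_dvdn; apply/eqP/permP=> a.
    by rewrite (hpX _ (a, 0%R)) expg_order !perm1.
  by move/pnat_dvd; apply.
rewrite hE; set a := x.1.
have : #|orbit 'P <[hp]> a| %| #|<[hp]>| by apply: dvdn_orbit.
move/(pnat_dvd)/(_ php)/p_natP=> [[|m] cm].
  have /eqP := cm; rewrite expn0 => /cards1P[b ob].
  have ha : h a \in orbit 'P <[hp]> a.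
    by apply/orbitP; exists hp; rewrite ?cycle_id //= apermE permE.
  by move: ha (orbit_refl 'P <[hp]> a); rewrite ob !inE => /eqP-> /eqP->.
have : orbit 'P <[hp]> a = setT.
  apply/eqP; rewrite eqEcard subsetT cardsT cardZp cm expnS leq_pmulr //.
  by rewrite expn_gt0 prime_gt0.
(* Some power of [hp] takes 0 to [a]; as it also fixes 0, [a] is 0. *)
move/setP/(_ 0%R); rewrite !inE orbit_sym => /orbitP[_ /cycleP[n ->]] /= e.
have fix0 k : (hp ^+ k) 0%R = 0%R.
  by elim: k => [|k IHk]; rewrite ?perm1 // expgSr permM IHk permE.
by move: e; rewrite apermE fix0 => <-.
Qed.

(** The elements of [Q] sending the fibre over 0 to that over [k] form the coset of [Q :&: shears]
    by [s ^+ k]. *)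
Lemma card_fibre_kernel (Q : {group {perm pt p}}) :
    Q \subset 'C[rho1 p] -> p.-group Q -> s \in Q ->
  #|Q| = (p * #|Q :&: shears|)%N.
Proof.
move=> cQ pQ Qs; pose o := (0, 0)%R : pt p.
pose F (k : 'Z_p) := [set g in Q | (g o).1 == k].
have FE k : F k = (Q :&: shears) :* (s ^+ k).
  apply/setP=> g; rewrite mem_rcoset !inE groupMr ?groupV ?groupX //.
  case Qg: (g \in Q) => //=.
  have Qgs : g * s ^- k \in Q by rewrite groupM ?groupV ?groupX.
  have e y : ((s ^- k) y).1 = (y.1 - k%:R)%R.
    by have := s_expE k ((s ^- k) y); rewrite permKV => ->; rewrite addrK.
  apply/eqP/idP=> [gk|].
    apply: fix_fibre_shears; first exact: (subsetP cQ).
      exact: mem_p_elt Qgs.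
    by rewrite permM e gk natr_Zp subrr.
  rewrite mem_shears => /andP[_ /forallP/(_ o)].
  by rewrite permM e natr_Zp subr_eq0 => /eqP.
rewrite -sum1_card (partition_big (fun g : {perm pt p} => (g o).1) predT) //=.
rewrite (eq_bigr (fun=> #|Q :&: shears|)) => [|k _].
  by rewrite sum_nat_const cardZp.
by rewrite -(card_rcoset _ (s ^+ k)) -FE sum1dep_card; apply: eq_card => g; rewrite !inE.
Qed.

(** * The elements [gamma p i] as iterated commutators *)

Lemma z_shear k : k < p -> z p k = shear [ffun a => (a == k%:R)%:R%R].
Proof.
move=> kp; apply/permP=> x; rewrite permE shearE ffunE /z_fun.
have -> : (x.1 == k :> nat) = (x.1 == k%:R%R).
  by rewrite -val_eqE /= val_Zp_nat // modn_small.
by case: eqP => _; rewrite ?addr0 -?surjective_pairing.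
Qed.

Lemma gamma_shear i :
  gamma p i = shear [ffun a : 'Z_p => (acoef (p - i) a)%:~R%R].
Proof.
rewrite /gamma.
under eq_bigr => k _ do rewrite (z_shear (ltn_ord k)) -shearMz.
rewrite -shear_sum; congr shear; apply/ffunP=> a; rewrite sum_ffunE ffunE.
have ap : a < p by have := ltn_ord a; rewrite [X in _ < X -> _]Zp_cast.
rewrite (bigD1 (Ordinal ap)) //= big1 => [|k neq].
  by rewrite addr0 ffunMzE ffunE natr_Zp eqxx.
rewrite ffunMzE ffunE; case: eqP => [e|]; last by rewrite mul0rz.
case/eqP: neq; apply: val_inj; rewrite /= e.
by rewrite val_Zp_nat // modn_small.
Qed.

Lemma acoef0 m : acoef m 0 = ((-1) ^+ m)%R.
Proof. by rewrite /acoef bin0 mul1r subn0. Qed.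

(** Pascal's rule with signs; it matches the difference in [shear_comm]. *)
Lemma acoefS m k : acoef m.+1 k.+1 = (acoef m k - acoef m k.+1)%R.
Proof.
rewrite /acoef binS subSS PoszD mulrDl addrC; congr (_ + _)%R.
case: (leqP k.+1 m) => [ltkm|lemk]; last by rewrite bin_small // !mul0r oppr0.
by rewrite -mulrN -[(m - k)%N]prednK ?subn_gt0 // exprS mulN1r subnS.
Qed.

Lemma acoef_small m k : m < k -> acoef m k = 0%R.
Proof. by move=> mk; rewrite /acoef bin_small // mul0r. Qed.

Lemma gamma_iter m : m < p -> gamma p (p - m) = iter m (commg^~ s) (z p 0).
Proof.
elim: m => [|m IHm] mp.
  rewrite gamma_shear z_shear ?prime_gt0 // subn0 subnn /=; congr shear.
  apply/ffunP=> a; rewrite !ffunE mulr0n -[_ == _]/(nat_of_ord a == 0).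
  by case: (nat_of_ord a) => [|k]; rewrite ?acoef0 ?expr0 ?acoef_small.
have mp' := ltnW mp.
rewrite iterS -(IHm mp') !gamma_shear shear_comm; congr shear.
apply/ffunP=> a; rewrite !ffunE !subKn // ?(ltnW mp') //.
rewrite -mulrzBr.
have ap : a < p by have := ltn_ord a; rewrite [X in _ < X -> _]Zp_cast.
rewrite -[a]natr_Zp; case: (val a) ap => [|k] kp; congr (_ *~ _)%R.
  (* The left neighbour of 0 wraps around to p - 1, where [acoef m] vanishes because m < p - 1. *)
  have -> : (0 - 1 = p.-1%:R :> 'Z_p)%R.
    apply/eqP; rewrite eq_sym -subr_eq opprK -mulrSr prednK ?prime_gt0 //.
    by rewrite pchar_Zp.
  rewrite [X in (acoef m X - _)%R]val_Zp_nat // modn_small ?prednK ?prime_gt0 //.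
  by rewrite [acoef m p.-1]acoef_small ?ltn_predRL // !acoef0 sub0r exprS mulN1r.
rewrite mulrSr addrK -mulrSr !val_Zp_nat // !modn_small ?(ltnW kp) //.
exact: acoefS.
Qed.

(** By [gamma_iter], this says that p - 1 commutations with [s] do not yet kill [z p 0]. *)
Lemma gamma1_neq1 : gamma p 1 != 1.
Proof.
rewrite gamma_shear -shear0 (inj_eq shear_injective).
apply/negP=> /eqP/ffunP/(_ 0%R); rewrite !ffunE acoef0 rmorph_sign => /eqP.
by rewrite signr_eq0.
Qed.

(** * The p-groups that centralize [rho1] and contain [s] *)

Lemma fibre_kernelE (Q : {group {perm pt p}}) m :
    Q \subset 'C[rho1 p] -> p.-group Q -> s \in Q -> #|Q| = (p ^ m.+1)%N ->
  Q :&: shears = [set x in shears | iter m (commg^~ s) x == 1].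
Proof.
move=> cQ pQ Qs cardQ.
apply: (uniserial_kerE (A := shears_group) p_pr) => //.
- exact: shears_abelian.
- exact: shears_pgroup.
- exact: shears_norm.
- exact: mem_p_elt Qs.
- exact: shears_cent.
- exact: subsetIr.
- rewrite -cycle_subG normsI // ?cycle_subG ?shears_norm //.
  exact: (subsetP (normG Q)).
apply/eqP; rewrite -(eqn_pmul2l (prime_gt0 p_pr)) -card_fibre_kernel //.
by rewrite cardQ expnS.
Qed.

(** The subgroup [R] generated by [s] and [gamma p i] lies in [Q]. Were it smaller, its fibre kernel
    would be the kernel of [D] iterated fewer than [i] times; then p - 1 iterations of [D] would
    kill [z p 0], contradicting [gamma1_neq1]. *)
Lemma pgroup_cent_rho1E (Q : {group {perm pt p}}) i :
    Q \subset 'C[rho1 p] -> p.-group Q -> s \in Q -> 0 < i ->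
    #|Q| = (p ^ i.+1)%N ->
  Q :=: <<[set s; gamma p i]>>.
Proof.
move=> cQ pQ Qs i_gt0 cardQ; pose D := commg^~ s.
have kerQ := fibre_kernelE cQ pQ Qs cardQ.
(* This makes the truncated [p - i] a true difference. *)
have le_ip : i <= p.
  rewrite -(leq_exp2l _ _ p_gt1) -card_shears.
  have /eqP := card_fibre_kernel cQ pQ Qs.
  rewrite cardQ expnS eqn_pmul2l ?prime_gt0 // => /eqP->.
  by rewrite subset_leq_card ?subsetIr.
have shD x : x \in shears -> iter p D x = 1.
  move=> shx.
  have := uniserial_kerE p_pr shears_abelian shears_pgroup shears_norm
    (mem_p_elt pQ Qs) shears_cent (subxx _) shears_norm card_shears.
  by move=> /= e; move: shx; rewrite e inE => /andP[_ /eqP].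
have gammaE : gamma p i = iter (p - i) D (z p 0).
  by rewrite -gamma_iter ?subKn // ltn_subrL i_gt0 prime_gt0.
have sh_gamma : gamma p i \in shears by rewrite gamma_shear imset_f.
have Qgamma : gamma p i \in Q.
  have : gamma p i \in Q :&: shears.
    rewrite kerQ inE sh_gamma gammaE -iterD subnKC // shD ?eqxx //.
    by rewrite z_shear ?prime_gt0 // imset_f.
  by case/setIP.
set R := <<_>>.
have sRQ : R \subset Q by rewrite gen_subG subUset !sub1set Qs.
have Rs : s \in R by rewrite mem_gen // !inE eqxx.
have Rgamma : gamma p i \in R by rewrite mem_gen // !inE eqxx orbT.
have pR : p.-group R := pgroupS sRQ pQ.
have cR := subset_trans sRQ cQ.
have cardR := card_fibre_kernel cR pR Rs.
have /p_natP[m cardK] : p.-nat #|R :&: shears|.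
  by apply: pgroupS (subsetIl _ _) pR.
have {}cardR : #|R| = (p ^ m.+1)%N by rewrite cardR cardK expnS.
apply/eqP; rewrite eq_sym eqEcard sRQ cardQ cardR leq_exp2l //.
rewrite ltnS leqNgt; apply/negP=> lt_mi.
have : gamma p i \in R :&: shears by rewrite inE Rgamma.
rewrite (fibre_kernelE cR pR Rs cardR) inE gammaE -iterD => /andP[_ /eqP e].
case/eqP: gamma1_neq1; rewrite -[1%N](subKn (prime_gt0 p_pr)).
rewrite gamma_iter ?ltn_subrL ?(prime_gt0 p_pr) //.
have le_m : m + (p - i) <= p - 1.
  by rewrite leq_subRL ?prime_gt0 // addnA -[leqRHS](subnKC le_ip) leq_add2r.
rewrite -(subnK le_m) iterD e.
by elim: (_ - _)%N => //= n ->; rewrite comm1g.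
Qed.

End Sigma.

(** * The cycle [tau] and its centralizer *)

Local Notation tau := (tau p_pr).

Let p2_gt1 : 1 < p ^ 2.
Proof. by rewrite -[1%N](exp1n 2) ltn_exp2r. Qed.

Lemma tauX n x : (tau ^+ n) x = ofZp2 (toZp2 x + n%:R)%R.
Proof.
elim: n => [|n IHn]; first by rewrite perm1 addr0 toZp2K.
by rewrite expgSr permM IHn permE /tau_fun ofZp2K // -addrA -mulrSr.
Qed.

Lemma toZp2E (x : pt p) : toZp2 x = (x.1 + x.2 * p)%:R%R.
Proof. by rewrite Zp_nat. Qed.

Lemma ofZp2_fst n : (ofZp2 (n%:R : 'Z_(p ^ 2))%R : pt p).1 = n%:R%R.
Proof.
rewrite -[LHS]Zp_nat val_Zp_nat // {2}(divn_eq n (p ^ 2)).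
by rewrite natrD natrM natrX pchar_Zp // expr0n mulr0 add0r.
Qed.

Lemma tau_fst x : (tau x).1 = (x.1 + 1)%R.
Proof.
rewrite permE /tau_fun toZp2E -mulrSr ofZp2_fst mulrSr natrD natrM pchar_Zp //.
by rewrite mulr0 addr0 natr_Zp.
Qed.

Lemma tau_expp : tau ^+ p = rho1 p.
Proof.
apply/permP=> x; rewrite tauX rho1E -[RHS](toZp2K p_pr); congr ofZp2.
have e : (x.2 + 1)%R = (x.2.+1 %% p)%N :> nat.
  by rewrite -{1}(natr_Zp x.2) -mulrSr val_Zp_nat.
rewrite !toZp2E e -natrD -addnA -mulSnr [LHS]natrD [RHS]natrD; congr (_ + _)%R.
(* The carry out of the second coordinate is a multiple of p^2. *)
rewrite {1}(divn_eq x.2.+1 p) mulnDl -mulnA mulnn natrD natrM pchar_Zp //.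
by rewrite mulr0 add0r.
Qed.

(** As [<[tau]>] is transitive, [g] is determined by the image of [o] and equals the power of [tau]
    with that image. *)
Lemma tau_cent : 'C[tau] \subset <[tau]>.
Proof.
apply/subsetP=> g /cent1P cg; pose o : pt p := (0, 0)%R.
have o0 : toZp2 o = 0%R by apply: val_inj; rewrite /= mod0n.
have tauo y : (tau ^+ toZp2 y) o = y by rewrite tauX o0 add0r natr_Zp toZp2K.
apply/cycleP; exists (toZp2 (g o)); apply/permP=> x.
rewrite -{1}(tauo x) -permM -(commuteX _ cg) permM -{1}(tauo (g o)).
by rewrite -!permM -!expgD addnC expgD permM tauo.
Qed.

Lemma order_rho1 : #[rho1 p] = p.
Proof.
apply: nt_prime_order => //.
  rewrite rho1_shear -shearMn -shear0; congr shear; apply/ffunP=> a.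
  by rewrite ffunMnE !ffunE pchar_Zp.
rewrite rho1_shear -shear0 (inj_eq shear_injective).
by apply/eqP=> /ffunP/(_ 0%R)/eqP; rewrite !ffunE oner_eq0.
Qed.

Lemma pgroup_tau_cent (P : {group {perm pt p}}) :
  p.-group P -> tau \in P -> P \subset 'C[rho1 p].
Proof.
move=> pP Ptau.
have rhoP : rho1 p \in P by rewrite -tau_expp groupX.
have ntZ : 'Z(P) != 1.
  rewrite (center_nil_eq1 (pgroup_nil pP)); apply: contraTneq rhoP => ->.
  by rewrite inE -order_eq1 order_rho1 gtn_eqF.
have sZ : 'Z(P) \subset <[tau]>.
  apply: subset_trans tau_cent; rewrite sub_cent1 (subsetP _ _ Ptau) //.
  by rewrite centsC subsetIr.
have sR : <[rho1 p]> \subset <[tau]> by rewrite cycle_subG -tau_expp mem_cycle.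
(* Inside the cyclic group [<[tau]>], inclusion of subgroups is divisibility of their orders. *)
have : <[rho1 p]> \subset 'Z(P).
  rewrite -(cardSg_cyclic (cycle_cyclic tau)) // -orderE order_rho1.
  by have [_ ? _] := pgroup_pdiv (pgroupS (center_sub P) pP) ntZ.
by rewrite cycle_subG sub_cent1 => /setIP[].
Qed.

(** * Translations and linear changes of coordinates *)

Lemma rho2E x : rho2 p x = ((x.1 + 1)%R, x.2).
Proof. by rewrite permE. Qed.

Lemma rhoXE (a b : 'Z_p) x :
  (rho2 p ^+ a * rho1 p ^+ b) x = ((x.1 + a)%R, (x.2 + b)%R).
Proof.
rewrite permM rho1_shear -shearMn shearE ffunMnE ffunE natr_Zp.
suff -> n : (rho2 p ^+ n) x = ((x.1 + n%:R)%R, x.2) by rewrite natr_Zp.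
elim: n => [|n IHn]; first by rewrite perm1 addr0 -surjective_pairing.
by rewrite expgSr permM IHn rho2E -addrA -mulrSr.
Qed.

Lemma cent_rho12E (g : {perm pt p}) :
    g \in 'C[rho1 p] -> g \in 'C[rho2 p] ->
  g = rho2 p ^+ (g (0, 0)%R).1 * rho1 p ^+ (g (0, 0)%R).2.
Proof.
move=> cg1 /cent1P cg2; apply/permP=> x.
have -> : x = (rho2 p ^+ x.1 * rho1 p ^+ x.2) (0, 0)%R.
  by rewrite rhoXE !add0r -surjective_pairing.
have cgx : commute g (rho2 p ^+ x.1 * rho1 p ^+ x.2).
  by apply: commuteM; apply: commuteX => //; apply/cent1P.
by rewrite -permM -cgx permM !rhoXE /= !add0r addrC [X in (_, X)]addrC.
Qed.

Lemma Zp_mul_inj (a : 'Z_p) : a != 0%R -> injective (fun y => y * a)%R.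
Proof.
move=> a0; apply: (can_inj (mulrK _)); rewrite -[a]natr_Zp unitZpE //.
have ap : a < p by have := ltn_ord a; rewrite [X in _ < X -> _]Zp_cast.
by rewrite prime_coprime // gtnNdvd // lt0n.
Qed.

(** Complete (a, b), the image of (0, 1), to a basis by (u, w): take (0, 1) if b = 0, with
    determinant -a, and (1, 0) otherwise, with determinant b. *)
Lemma exists_Aut (a b : 'Z_p) : (a, b) != (0, 0)%R ->
  exists2 beta : {perm pt p}, beta \in Aut [set: pt p] &
    exists u w, forall x,
      beta x = ((x.1 * u + x.2 * a)%R, (x.1 * w + x.2 * b)%R).
Proof.
move=> ab0.
pose F (u w : 'Z_p) (x : pt p) : pt p :=
  ((x.1 * u + x.2 * a)%R, (x.1 * w + x.2 * b)%R).
have Feq u w x y (e : F u w x = F u w y) :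
    (x.1 * u + x.2 * a = y.1 * u + y.2 * a)%R /\
    (x.1 * w + x.2 * b = y.1 * w + y.2 * b)%R.
  by split; [apply: (congr1 fst e) | apply: (congr1 snd e)].
have [u [w inj]] : exists u w, injective (F u w).
  have [b0|b0] := eqVneq b 0%R.
    have a0 : a != 0%R by move: ab0; rewrite b0 xpair_eqE eqxx andbT.
    exists 0%R, 1%R => x y /Feq[]; rewrite b0 !mulr0 !mulr1 !add0r !addr0.
    move=> /(Zp_mul_inj a0) e2 e1.
    by rewrite [x]surjective_pairing e1 e2 -surjective_pairing.
  exists 1%R, 0%R => x y /Feq[]; rewrite !mulr0 !mulr1 !add0r.
  move=> e1 /(Zp_mul_inj b0) e2; move: e1; rewrite e2 => /addIr e1.
  by rewrite [x]surjective_pairing e1 e2 -surjective_pairing.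
exists (perm inj); last by exists u, w => x; rewrite permE.
rewrite inE; apply/andP; split; first by apply/subsetP=> x _; rewrite inE.
apply/morphicP=> x y _ _; rewrite !permE /=.
congr pair; rewrite /= !mulrDl; exact: addrACA.
Qed.

(** A nontrivial central [c] is a translation, and a linear [beta] conjugates [rho1] to [c]. It
    conjugates [rho2] to a translation too, hence into [P], so undoing [beta] keeps both
    generators. *)
Lemma pgroup_rho_conj (P : {group {perm pt p}}) :
    p.-group P -> rho1 p \in P -> rho2 p \in P ->
  exists2 alpha : {perm pt p}, alpha \in Aut [set: pt p] &
    [/\ P :^ alpha^-1 \subset 'C[rho1 p], rho1 p \in P :^ alpha^-1
       & rho2 p \in P :^ alpha^-1].
Proof.
move=> pP P1 P2.
have ntZ : 'Z(P) != 1.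
  rewrite (center_nil_eq1 (pgroup_nil pP)); apply: contraTneq P1 => ->.
  by rewrite inE -order_eq1 order_rho1 gtn_eqF.
have [c /setIP[Pc cPc] ntc] := trivgPn _ ntZ.
have cc g : g \in P -> c \in 'C[g].
  by move=> Pg; apply/cent1P; apply: (centP cPc).
have cE := cent_rho12E (cc _ P1) (cc _ P2).
set a := (c _).1 in cE; set b := (c _).2 in cE.
have ab0 : (a, b) != (0, 0)%R.
  by apply: contraNneq ntc => -[a0 b0]; rewrite cE a0 b0 mulg1.
have [beta Abeta [u [w betaE]]] := exists_Aut ab0.
have rho1b : rho1 p ^ beta = c.
  apply/permP=> y; rewrite -[y](permKV beta) permJ cE rhoXE !betaE rho1E /=.
  by rewrite !mulrDl !mul1r !addrA.
have rho2b : rho2 p ^ beta = rho2 p ^+ u * rho1 p ^+ w.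
  apply/permP=> y; rewrite -[y](permKV beta) permJ rhoXE !betaE rho2E /=.
  by rewrite !mulrDl !mul1r addrAC [X in (_, X)]addrAC.
exists beta => //; split.
- by rewrite sub_cent1 centJ mem_conjgV rho1b.
- by rewrite mem_conjgV rho1b.
by rewrite mem_conjgV rho2b groupM ?groupX.
Qed.

End Shear.

Theorem theorem9 (p : nat) (p_pr : prime p) (G P : {group {perm pt p}})
    (G_trans : [transitive G, on [set: pt p] | 'P])
    (P_Syl : P \in 'Syl_p(G))
    (i : nat) (i_ge1 : (1 <= i)%N) (P_card : #|P| = (p ^ i.+1)%N) :
  (tau p_pr \in P -> P :=: Pgrp p_pr i) /\
  (<<[set rho1 p; rho2 p]>> \subset P ->
     exists2 alpha : {perm pt p},
       alpha \in Aut [set: pt p] & P :=: Pgrp' p i :^ alpha).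
Proof.
have pP : p.-group P by rewrite /pgroup P_card pnatX pnat_id.
split=> [Ptau|].
  have cP := pgroup_tau_cent pP Ptau.
  have ctau := subsetP cP _ Ptau.
  exact: (pgroup_cent_rho1E p_pr ctau (tau_fst p_pr)).
rewrite gen_subG subUset !sub1set => /andP[P1 P2].
have [alpha Aalpha [cQ Q1 Q2]] := pgroup_rho_conj p_pr pP P1 P2.
exists alpha => //.
have pQ : p.-group (P :^ alpha^-1) by rewrite pgroupJ.
have cardQ : #|P :^ alpha^-1| = (p ^ i.+1)%N by rewrite cardJg.
have rho2_fst x : (rho2 p x).1 = (x.1 + 1)%R by rewrite rho2E.
have QE := pgroup_cent_rho1E p_pr (subsetP cQ _ Q2) rho2_fst cQ pQ Q2 i_ge1 cardQ.
rewrite -[LHS](conjsgKV alpha); congr (_ :^ alpha); rewrite QE.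
(* The additional generator [rho1] of [Pgrp'] already lies in the conjugate of [P]. *)
apply/eqP; rewrite eqEsubset genS /=; last first.
  by apply/subsetP=> x; rewrite !inE => /orP[] ->; rewrite ?orbT.
by rewrite gen_subG /= -QE !subUset !sub1set Q1 Q2 QE mem_gen // !inE eqxx orbT.
Qed.
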